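(* Let $\mathcal{E}$ be a finite dimensional $\mathfrak{A}$-submodule of $C^\infty(\mathbb{R}^2)\otimes_{\mathbb{R}}\mathbb{C}$. Then there exists a basis for $\mathcal{E}$ consisting of functions of the form $e^{\alpha_1x^1+\alpha_2x^2}p(x^1,x^2)$ with $p$ a polynomial and $\alpha_1,\alpha_2\in\mathbb{C}$. Furthermore, for each such function one has $e^{\alpha_1x^1+\alpha_2x^2}\,\partial_{x^i}p\in\mathcal{E}$ for $i=1,2$.
   Context: $(x^1,x^2)$ are the standard coordinates on $\mathbb{R}^2$, and $\mathfrak{A}$ is the commutative unital algebra of differential operators generated by $\partial_{x^1}$ and $\partial_{x^2}$. A finite dimensional $\mathfrak{A}$-submodule of $C^\infty(\mathbb{R}^2)\otimes_{\mathbb{R}}\mathbb{C}$ (the complex-valued smooth functions) is a finite dimensional complex linear subspace that is invariant under $\partial_{x^1}$ and $\partial_{x^2}$. Polynomials have complex coefficients. *)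

(* Defs.v *)
From HB Require Import structures.
From mathcomp Require Import all_boot all_order all_algebra.
From mathcomp Require Import complex.
From mathcomp Require Import all_classical all_reals all_analysis.
(* the notations of mpoly clash with those of MathComp-Analysis *)
From mathcomp Require Import -(notations) mpoly.
Import Order.TTheory GRing.Theory Num.Theory numFieldNormedType.Exports.
Set Implicit Arguments.
Unset Strict Implicit.
Unset Printing Implicit Defensive.
Local Open Scope classical_set_scope.
Local Open Scope complex_scope.
Local Open Scope ring_scope.

Section LinearAlgebra.
Variables (K : fieldType) (V : lmodType K).

Definition lin_indep n (b : 'I_n -> V) : Prop :=
  forall c : 'I_n -> K, \sum_(j < n) c j *: b j = 0 -> forall j, c j = 0.

Definition lin_span n (b : 'I_n -> V) : set V :=
  [set v | exists c : 'I_n -> K, v = \sum_(j < n) c j *: b j].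

Definition is_basis (E : set V) n (b : 'I_n -> V) : Prop :=
  lin_indep b /\ lin_span b = E.

Definition finite_dimensional (E : set V) : Prop :=
  exists n (b : 'I_n -> V), is_basis E b.

End LinearAlgebra.

Section Functions.
Variable R : realType.

(* x^1 and x^2 are the coordinates of index 0 and 1 of x : 'rV[R]_2 *)
Definition partial (i : 'I_2) (f : 'rV[R]_2 -> R) : 'rV[R]_2 -> R :=
  'D_(delta_mx 0 i) f.

Definition iter_partial (s : seq 'I_2) (f : 'rV[R]_2 -> R) : 'rV[R]_2 -> R :=
  foldr partial f s.

(* C^oo: partial derivatives of all orders exist and are continuous. The
   existence clause is needed because 'D_v f is total. *)
Definition smooth (f : 'rV[R]_2 -> R) : Prop :=
  forall s : seq 'I_2,
    continuous (iter_partial s f) /\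
    forall (i : 'I_2) (x : 'rV[R]_2),
      derivable (iter_partial s f) x (delta_mx 0 i).

(* C^oo(R^2) (x)_R C, an element u (x) 1 + v (x) i being the function u +i* v *)
Definition csmooth (f : 'rV[R]_2 -> R[i]) : Prop :=
  smooth (fun x => complex.Re (f x)) /\ smooth (fun x => complex.Im (f x)).

Definition cpartial (i : 'I_2) (f : 'rV[R]_2 -> R[i]) : 'rV[R]_2 -> R[i] :=
  fun x => partial i (fun y => complex.Re (f y)) x +i*
           partial i (fun y => complex.Im (f y)) x.

(* A submodule over the algebra generated by the partial derivatives; the
   linear structure on 'rV[R]_2 -> R[i] is the one over R[i]. *)
Definition diff_submodule (E : set ('rV[R]_2 -> R[i])) : Prop :=
  [/\ E `<=` csmooth,
      GRing.submod_closed [in E] &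
      forall (i : 'I_2) f, E f -> E (cpartial i f)].

Definition cexp (z : R[i]) : R[i] :=
  (expR (complex.Re z))%:C * (cos (complex.Im z) +i* sin (complex.Im z)).

Definition exp_poly (a : 'I_2 -> R[i]) (p : mpoly 2 R[i]) : 'rV[R]_2 -> R[i] :=
  fun x => cexp (\sum_(i < 2) a i * (x 0 i)%:C)
           * meval (fun i => (x 0 i)%:C) p.

End Functions.

(* Main.v *)
(* Write the partial derivatives on a basis of E as matrices M_1 and M_2.  If f
   in E satisfies (d/dx^i - a)^N f = 0, then on every line parallel to the i-th
   axis f solves a linear ODE with constant coefficients, whence
     f(x) = e^{a x^i} sum_{j < N} (x^i)^j / j! ((d/dx^i - a)^j f)(x with x^i = 0).
   Expanding generalized eigenvectors of M_1 in this way and differentiating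
   term by term shows that M_1 and M_2 commute, so that E is spanned by joint
   generalized eigenvectors.  For such an f the expansion can be applied in both
   variables, and exhibits f as an exponential times a polynomial. *)
Require Import Defs.
From HB Require Import structures.
From mathcomp Require Import all_boot all_order all_algebra.
From mathcomp Require Import complex.
From mathcomp Require Import all_classical all_reals all_analysis.
From mathcomp Require Import -(notations) mpoly.
From mathcomp Require Import ring.
Import Order.TTheory GRing.Theory Num.Theory numFieldNormedType.Exports.
Set Implicit Arguments.
Unset Strict Implicit.
Unset Printing Implicit Defensive.
Local Open Scope classical_set_scope.
Local Open Scope complex_scope.
Local Open Scope ring_scope.

(** * Complex-valued functions of a real variable and constant-coefficient linear ODEs *)

Section ComplexDerivative.
Variable R : realType.
Implicit Types (f g : R -> R[i]) (t : R) (c d : R[i]).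

Lemma cReD (c d : R[i]) : complex.Re (c + d) = complex.Re c + complex.Re d.
Proof. by case: c; case: d. Qed.

Lemma cImD (c d : R[i]) : complex.Im (c + d) = complex.Im c + complex.Im d.
Proof. by case: c; case: d. Qed.

Lemma cReM (c d : R[i]) : complex.Re (c * d) =
  complex.Re c * complex.Re d - complex.Im c * complex.Im d.
Proof. by case: c; case: d. Qed.

Lemma cImM (c d : R[i]) : complex.Im (c * d) =
  complex.Re c * complex.Im d + complex.Im c * complex.Re d.
Proof. by case: c => a b; case: d => a' b'; rewrite /= [_ * a']mulrC. Qed.

(** Existence and value of the derivative are recorded together, componentwise, so that the real
    differentiation rules apply to both parts. *)
Definition is_cderive t f d : Prop :=
  is_derive t 1 (fun s => complex.Re (f s)) (complex.Re d) /\
  is_derive t 1 (fun s => complex.Im (f s)) (complex.Im d).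

Lemma is_cderive_unique t f c d : is_cderive t f c -> is_cderive t f d -> c = d.
Proof.
move=> [fcr fci] [fdr fdi]; case: c d fcr fci fdr fdi => a b [a' b'] /=.
move=> [_ <-] [_ <-] [_ <-] [_ <-] //.
Qed.

Lemma is_cderive_cst t c : is_cderive t (fun=> c) 0.
Proof. by split; exact: is_derive_cst. Qed.

Lemma is_cderive_id t : is_cderive t (fun s => s%:C) 1.
Proof. by split; [exact: is_derive_id|exact: is_derive_cst]. Qed.

Lemma is_cderiveD t f g c d : is_cderive t f c -> is_cderive t g d ->
  is_cderive t (fun s => f s + g s) (c + d).
Proof.
move=> [fr fi] [gr gi]; split.
  rewrite cReD; under eq_fun do rewrite cReD; exact: is_deriveD.
rewrite cImD; under eq_fun do rewrite cImD; exact: is_deriveD.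
Qed.

Lemma is_cderiveM t f g c d : is_cderive t f c -> is_cderive t g d ->
  is_cderive t (fun s => f s * g s) (c * g t + f t * d).
Proof.
move=> [fr fi] [gr gi]; split.
  under eq_fun do rewrite cReM.
  apply: (@is_derive_eq _ _ _ _ _ _ _ _
    (is_deriveB (is_deriveM fr gr) (is_deriveM fi gi))).
  by rewrite cReD !cReM /GRing.scale /=; ring.
under eq_fun do rewrite cImM.
apply: (@is_derive_eq _ _ _ _ _ _ _ _
  (is_deriveD (is_deriveM fr gi) (is_deriveM fi gr))).
by rewrite cImD !cImM /GRing.scale /=; ring.
Qed.

Lemma is_cderiveZ t f c d : is_cderive t f d ->
  is_cderive t (fun s => c * f s) (c * d).
Proof.
by move=> fd; have := is_cderiveM (is_cderive_cst t c) fd; rewrite mul0r add0r.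
Qed.

Lemma is_cderive_sum t (I : Type) (r : seq I) (F : I -> R -> R[i])
    (dF : I -> R[i]) : (forall i, is_cderive t (F i) (dF i)) ->
  is_cderive t (fun s => \sum_(i <- r) F i s) (\sum_(i <- r) dF i).
Proof.
move=> FdF; elim: r => [|i r IH].
  by rewrite big_nil; under eq_fun do rewrite big_nil; exact: is_cderive_cst.
by rewrite big_cons; under eq_fun do rewrite big_cons; exact: is_cderiveD.
Qed.

(** At [n = 0] the truncated exponent [n.-1] is harmless, since the factor [n%:R] vanishes. *)
Lemma is_cderiveX t n :
  is_cderive t (fun s => s%:C ^+ n) (n%:R * t%:C ^+ n.-1).
Proof.
elim: n => [|n IH]; first by rewrite mul0r; exact: is_cderive_cst.
under eq_fun do rewrite exprS.
have := is_cderiveM (is_cderive_id t) IH; congr is_cderive.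
by case: n {IH} => [|n]; rewrite /= ?exprS; ring.
Qed.

Lemma is_cderive_eq0 f : (forall t, is_cderive t f 0) -> forall s t, f s = f t.
Proof.
move=> f0 s t; apply/eqP; rewrite eq_complex; apply/andP; split; apply/eqP.
  apply: (@is_derive_0_is_cst _ (fun x => complex.Re (f x))) => x.
  by have [] := f0 x.
apply: (@is_derive_0_is_cst _ (fun x => complex.Im (f x))) => x.
by have [] := f0 x.
Qed.

Lemma cexp0 : cexp 0 = 1 :> R[i].
Proof. by rewrite /cexp /= expR0 cos0 sin0 mul1r. Qed.

Lemma cexpD c d : cexp (c + d) = cexp c * cexp d.
Proof.
rewrite /cexp cReD cImD expRD cosD sinD.
by case: c => a b; case: d => a' b' /=; simpc; congr Complex; ring.
Qed.

Lemma is_cderive_cexp t c d :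
  is_cderive t (fun s => cexp (c * s%:C + d)) (c * cexp (c * t%:C + d)).
Proof.
have lin (u v x : R) : is_derive x 1 (fun s => u * s + v) u.
  apply: (@is_derive_eq _ _ _ _ _ _ _ _
    (is_deriveD (is_deriveZ u (is_derive_id x 1)) (is_derive_cst v x 1))).
  by rewrite addr0 /GRing.scale /= mulr1.
case: c d => a b [a' b'].
have E s : cexp ((a +i* b) * s%:C + (a' +i* b')) =
  (expR (a * s + a') * cos (b * s + b')) +i*
  (expR (a * s + a') * sin (b * s + b')).
  by rewrite /cexp; simpc; rewrite addrC.
under eq_fun do rewrite E.
rewrite E {E}.
have dexp := @is_derive1_comp _ _ (fun s => a * s + a') t _ _
    (is_derive_expR (a * t + a')) (lin a a' t).
have dcos := @is_derive1_comp _ _ (fun s => b * s + b') t _ _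
    (is_derive_cos (b * t + b')) (lin b b' t).
have dsin := @is_derive1_comp _ _ (fun s => b * s + b') t _ _
    (is_derive_sin (b * t + b')) (lin b b' t).
split => /=.
  apply: (@is_derive_eq _ _ _ _ _ _ _ _ (is_deriveM dexp dcos)).
  by rewrite /GRing.scale /=; ring.
apply: (@is_derive_eq _ _ _ _ _ _ _ _ (is_deriveM dexp dsin)).
by rewrite /GRing.scale /=; ring.
Qed.

(** The polynomial of degree less than [N] whose [j]-th derivative at 0 is [u j] for [j < N]. *)
Definition taylor N (u : nat -> R[i]) t : R[i] :=
  \sum_(0 <= j < N) j`!%:R^-1 * t%:C ^+ j * u j.

Lemma is_cderive_taylor N u t :
  is_cderive t (taylor N.+1 u) (taylor N (fun j => u j.+1) t).
Proof.
rewrite /taylor; set v := (X in is_cderive _ _ X).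
have -> : v = \sum_(0 <= j < N.+1) j`!%:R^-1 * (j%:R * t%:C ^+ j.-1) * u j.
  rewrite big_nat_recl //= mul0r mulr0 mul0r add0r /v.
  apply: eq_bigr => j _; rewrite factS natrM invfM mulrACA mulVf ?mul1r//.
apply: is_cderive_sum => j.
have := is_cderiveM (is_cderiveZ (j`!%:R^-1) (is_cderiveX t j))
  (is_cderive_cst t (u j)).
by rewrite mulr0 addr0.
Qed.

Lemma taylor0 N u : taylor N.+1 u 0 = u 0.
Proof.
rewrite /taylor big_nat_recl //= expr0 fact0 invr1 !mul1r big1 ?addr0// => j _.
by rewrite exprS mul0r mulr0 mul0r.
Qed.

Lemma is_cderive_exp_taylor a N u t :
  is_cderive t (fun s => cexp (a * s%:C) * taylor N.+1 u s)
    (a * (cexp (a * t%:C) * taylor N.+1 u t) +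
     cexp (a * t%:C) * taylor N (fun j => u j.+1) t).
Proof.
have de : is_cderive t (fun s => cexp (a * s%:C)) (a * cexp (a * t%:C)).
  have := is_cderive_cexp t a 0; rewrite addr0; congr is_cderive.
  by apply/funext => s; rewrite addr0.
by rewrite mulrA; exact: is_cderiveM de (is_cderive_taylor _ _ _).
Qed.

(** Multiplying by the integrating factor [cexp (- a * t)] gives a function with zero derivative,
    hence constant and equal to its value 0 at the origin. *)
Lemma linear_ode_eq0 a f : (forall t, is_cderive t f (a * f t)) -> f 0 = 0 ->
  forall t, f t = 0.
Proof.
move=> df f0 t.
have cst s : cexp (- a * s%:C + 0) * f s = 0.
  rewrite (@is_cderive_eq0 (fun s => cexp (- a * s%:C + 0) * f s) _ s 0).
    by rewrite f0 mulr0.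
  move=> x; have := is_cderiveM (is_cderive_cexp x (- a) 0) (df x).
  congr is_cderive; ring.
have := congr1 (fun z => cexp (a * t%:C) * z) (cst t).
by rewrite addr0 mulr0 mulrA -cexpD mulNr subrr cexp0 mul1r.
Qed.

(** Here [u j] plays the role of (d/dt - a)^j applied to [u 0]. By induction [u 1] has the claimed
    form, so [u 0] and its candidate solve the same inhomogeneous equation with the same value at 0;
    their difference solves the homogeneous one. *)
Lemma jordan_chain_solution a N (u : nat -> R -> R[i]) :
  (forall j t, is_cderive t (u j) (a * u j t + u j.+1 t)) ->
  (forall t, u N t = 0) ->
  forall t, u 0 t = cexp (a * t%:C) * taylor N (fun j => u j 0) t.
Proof.
elim: N u => [|N IH] u du uN t.
  by rewrite uN /taylor big_nil mulr0.
have u1 := IH (fun j => u j.+1) (fun j => du j.+1) uN.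
apply/eqP; rewrite -subr_eq0; apply/eqP.
apply: (@linear_ode_eq0 a (fun s => u 0 s - _)); last first.
  by rewrite taylor0 mulr0 cexp0 mul1r subrr.
move=> s.
have := is_cderiveD (du 0 s) (is_cderiveZ (-1)
  (is_cderive_exp_taylor a N (fun j => u j 0) s)).
rewrite u1; congr is_cderive; last by ring.
by apply/funext => x; rewrite mulN1r.
Qed.

End ComplexDerivative.

(** * Partial derivatives as derivatives along lines parallel to the axes *)

Section PartialDerivatives.
Variable R : realType.
Implicit Types (x : 'rV[R]_2) (f : 'rV[R]_2 -> R[i]).

(** The line is parametrised by the coordinate itself, not by the increment from [x], so that all
    points of one line yield the same function of [t]. *)
Definition along (i : 'I_2) x (t : R) : 'rV[R]_2 :=
  \row_j (if j == i then t else x 0 j).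

Lemma along_id i x : along i x (x 0 i) = x.
Proof. by apply/rowP => j; rewrite mxE; case: eqP => [->|]. Qed.

Lemma along_along i x s t : along i (along i x s) t = along i x t.
Proof. by apply/rowP => j; rewrite !mxE; case: eqP. Qed.

Lemma along_coord i x t : along i x t 0 i = t.
Proof. by rewrite mxE eqxx. Qed.

Lemma alongD i x s t : s *: delta_mx 0 i + along i x t = along i x (s + t).
Proof.
apply/rowP => j; rewrite !mxE eqxx /=.
by case: eqP => _; rewrite ?mulr1 ?mulr0 ?add0r.
Qed.

(** Equality of the difference quotients transfers both the existence and the value of the
    derivative. *)
Lemma along_quotientE (f : 'rV[R]_2 -> R) i x t :
  (fun h : R => h^-1 *: ((f \o shift (along i x t)) (h *: delta_mx 0 i)
                         - f (along i x t))) =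
  (fun h : R => h^-1 *: (((fun s => f (along i x s)) \o shift t) (h *: 1)
                         - f (along i x t))).
Proof.
by apply/funext => h /=; rewrite alongD /GRing.scale /= mulr1.
Qed.

Lemma partial_alongE (f : 'rV[R]_2 -> R) i x t :
  partial i f (along i x t) = 'D_1 (fun s => f (along i x s)) t.
Proof. by rewrite /partial /derive along_quotientE. Qed.

Lemma is_derive_along (f : 'rV[R]_2 -> R) i x t :
  derivable f (along i x t) (delta_mx 0 i) ->
  is_derive t 1 (fun s => f (along i x s)) (partial i f (along i x t)).
Proof.
move=> H; split; last by rewrite partial_alongE.
by move: H; rewrite /derivable along_quotientE.
Qed.

Definition is_cpartial (i : 'I_2) f x (d : R[i]) : Prop :=
  is_cderive (x 0 i) (fun t => f (along i x t)) d.

Lemma is_cpartialE i f x d : is_cpartial i f x d -> cpartial i f x = d.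
Proof.
move=> [fr fi]; rewrite /cpartial -{1 2}(along_id i x) !partial_alongE.
by rewrite !derive_val; case: d {fr fi}.
Qed.

Lemma csmooth_is_cpartial i f x :
  csmooth f -> is_cpartial i f x (cpartial i f x).
Proof.
move=> [fr fi]; rewrite /cpartial -{2 3}(along_id i x).
split; apply: is_derive_along; rewrite along_id.
  exact: (fr [::]).2.
exact: (fi [::]).2.
Qed.

Lemma is_cpartial_along i f d : (forall x, is_cpartial i f x (d x)) ->
  forall x t, is_cderive t (fun s => f (along i x s)) (d (along i x t)).
Proof.
move=> fd x t; have := fd (along i x t); rewrite /is_cpartial along_coord.
by under eq_fun do rewrite along_along.
Qed.

(** The polynomials with this property contain 0, 1 and the variables and are closed under products
    and linear combinations. *)
Lemma is_cpartial_meval i (p : mpoly 2 R[i]) x :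
  is_cpartial i (fun y => meval (fun k => (y 0 k)%:C) p) x
    (meval (fun k => (x 0 k)%:C) (mderiv i p)).
Proof.
pose P (q : mpoly 2 R[i]) := is_cpartial i
  (fun y => meval (fun k => (y 0 k)%:C) q) x
  (meval (fun k => (x 0 k)%:C) (mderiv i q)).
have P0 : P 0.
  rewrite /P mderiv0 meval0; rewrite /is_cpartial.
  by under eq_fun do rewrite meval0; exact: is_cderive_cst.
have P1 : P 1.
  rewrite /P -mpolyC1 mderivC meval0 /is_cpartial.
  by under eq_fun do rewrite mevalC; exact: is_cderive_cst.
have PM q r : P q -> P r -> P (q * r).
  rewrite /P mderivM mevalD !mevalM /is_cpartial => Pq Pr.
  under eq_fun do rewrite mevalM.
  by have := is_cderiveM Pq Pr; rewrite along_id.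
have PX k : P (mpolyX _ (mnm1 k)).
  rewrite /P mderivX mevalZ mnm1E /is_cpartial.
  under eq_fun do rewrite mevalXU mxE.
  have [<-|ki] := eqVneq.
    rewrite mul1r (_ : mnm_sub _ _ = mnm0).
      by rewrite mpolyX0 meval1; exact: is_cderive_id.
    by apply/mnmP => l; rewrite mnmBE mnm0E subnn.
  by rewrite mul0r; exact: is_cderive_cst.
have PZD c q r : P q -> P r -> P (c *: q + r).
  rewrite /P mderivD mderivZ mevalD mevalZ /is_cpartial => Pq Pr.
  under eq_fun do rewrite mevalD mevalZ.
  by apply: is_cderiveD => //; exact: is_cderiveZ.
rewrite -/(P p); clearbody P.
have PXn k n : P (mpolyX _ (mnm1 k) ^+ n).
  by elim: n => [//|n IH]; rewrite exprS; exact: PM.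
elim/mpolyind: p => [//|c m p _ _ Pp]; apply: (PZD) => //.
rewrite mpolyXE_id; apply: (big_ind P P1 PM) => k _; exact: PXn.
Qed.

Lemma is_cpartial_exp_poly i a (p : mpoly 2 R[i]) x :
  is_cpartial i (exp_poly a p) x (exp_poly a (a i *: p + mderiv i p) x).
Proof.
(* Along the line only the [i]-th term of the exponent moves; the rest is a constant. *)
have E y t : \sum_(k < 2) a k * (along i y t 0 k)%:C =
    a i * t%:C + \sum_(k < 2 | k != i) a k * (y 0 k)%:C.
  rewrite (bigD1 i) //= along_coord; congr (_ + _).
  by apply: eq_bigr => k /negPf ki; rewrite mxE ki.
rewrite /exp_poly mevalD mevalZ -[in cexp _](along_id i x) E.
rewrite /is_cpartial; under eq_fun do rewrite E.
have := is_cderiveM (is_cderive_cexp _ (a i) _) (is_cpartial_meval i p x).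
move=> /(_ (\sum_(k < 2 | k != i) a k * (x 0 k)%:C)); congr is_cderive.
by rewrite along_id; ring.
Qed.

Lemma cpartial_exp_poly i a (p : mpoly 2 R[i]) :
  cpartial i (exp_poly a p) = exp_poly a (a i *: p + mderiv i p).
Proof.
by apply/funext => x; apply: is_cpartialE; exact: is_cpartial_exp_poly.
Qed.

End PartialDerivatives.

(** * Generalized eigenvectors over an algebraically closed field *)

Section GeneralizedEigenvectors.
Variable K : closedFieldType.

(** Induction on the size of a nonzero polynomial [p] with [v *m p(M) = 0], starting from the
    characteristic polynomial. The predicate [P] lets the decomposition take place inside a subspace
    stable under [M]. *)
Lemma generalized_eigenvector_ind n (M : 'M[K]_n.+1)
    (P Q : 'rV[K]_n.+1 -> Prop) :
  (forall w p, P w -> P (w *m horner_mx M p)) ->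
  Q 0 -> (forall v w, Q v -> Q w -> Q (v + w)) ->
  (forall w a N, P w -> w *m (M - a%:M) ^+ N = 0 -> Q w) ->
  forall v, P v -> Q v.
Proof.
move=> Ph Q0 QD Qeig v Pv.
have : v *m horner_mx M (char_poly M) = 0 by rewrite Cayley_Hamilton mulmx0.
have : char_poly M != 0 by rewrite monic_neq0 // char_poly_monic.
move: (char_poly M) => p; have [s] := ubnP (size p).
elim: s p v Pv => // s IH p v Pv ps p0 vp.
(* Either [p] has a root, or it is a nonzero constant and then [v = 0]. *)
have [/closed_rootP[a pa]|] := boolP (size p != 1); last first.
  move/negbNE/eqP => p1; move: vp p0; rewrite (size1_polyC (eq_leq p1)).
  rewrite horner_mx_C mul_mx_scalar polyC_eq0 => /eqP.
  by rewrite scaler_eq0 => /orP[->//|/eqP->].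
have [m [q]] := multiplicity_XsubC p a; rewrite p0 /= => qa pE.
have m0 : (0 < m)%N.
  by case: m pE => // pE; move: pa; rewrite pE expr0 mulr1 (negPf qa).
have /Bezout_eq1_coprimepP[[u w] /= uw] : coprimep q (('X - a%:P) ^+ m).
  by rewrite coprimep_expr// coprimep_XsubC.
have hX : horner_mx M (('X - a%:P) ^+ m) = (M - a%:M) ^+ m.
  by rewrite rmorphXn /= rmorphB /= horner_mx_X horner_mx_C.
have q0 : q != 0 by apply: contraNneq p0 => q0; rewrite pE q0 mul0r.
(* The Bezout relation splits [v] into a part killed by [(M - a)^m] and a part killed by [q(M)],
   where [q] is smaller than [p] because [m > 0]. *)
have -> : v = v *m horner_mx M (u * q) +
              v *m horner_mx M (w * ('X - a%:P) ^+ m).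
  by rewrite -mulmxDr -rmorphD /= uw rmorph1 mulmx1.
apply: QD.
  apply: (Qeig _ a m); first exact: Ph.
  rewrite -hX -mulmxA -[_ *m horner_mx _ _](rmorphM (horner_mx M)) -mulrA -pE.
  by rewrite mulrC rmorphM /= mulmxA vp mul0mx.
apply: (IH q) => //; first exact: Ph.
  rewrite -ltnS (leq_trans _ ps)// ltnS pE size_mul ?expf_neq0 ?polyXsubC_eq0//.
  by rewrite size_exp_XsubC addnS /= -[X in (X < _)%N]addn0 ltn_add2l.
rewrite -mulmxA -[_ *m horner_mx _ _](rmorphM (horner_mx M)) -mulrA.
by rewrite [X in _ * X]mulrC -pE mulrC rmorphM /= mulmxA vp mul0mx.
Qed.

(** Since [M'] commutes with [M], it preserves the kernel of each [(M - a)^N], so each generalized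
    eigenvector of [M] decomposes under [M'] within that kernel. *)
Lemma joint_generalized_eigenvector_ind n (M M' : 'M[K]_n.+1)
    (Q : 'rV[K]_n.+1 -> Prop) : GRing.comm M M' ->
  Q 0 -> (forall v w, Q v -> Q w -> Q (v + w)) ->
  (forall w a a' N N', w *m (M - a%:M) ^+ N = 0 ->
     w *m (M' - a'%:M) ^+ N' = 0 -> Q w) ->
  forall v, Q v.
Proof.
move=> MM' Q0 QD Qeig v.
apply: (@generalized_eigenvector_ind n M (fun=> True) Q) => // {v}v a N _ va.
apply: (@generalized_eigenvector_ind n M'
  (fun w => w *m (M - a%:M) ^+ N = 0) Q) => // [w p wa|w a' N' wa wa'].
  rewrite -mulmxA (_ : horner_mx M' p *m _ = (M - a%:M) ^+ N *m horner_mx M' p).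
    by rewrite mulmxA wa mul0mx.
  apply/esym/commr_sym/commrX/commrB; last exact: comm_mx_scalar.
  by apply/commr_sym; exact: comm_mx_horner.
exact: (Qeig w a a' N N').
Qed.

End GeneralizedEigenvectors.

(** The hypothesis says that sums of vectors of [G] exhaust the space, in the form of an induction
    principle. A maximal independent family of rows from [G] then has full rank. *)
Lemma invertible_rows (K : fieldType) n (G : 'rV[K]_n -> Prop) :
  (forall Q : 'rV[K]_n -> Prop, Q 0 ->
     (forall v w, Q v -> Q w -> Q (v + w)) -> (forall v, G v -> Q v) ->
     forall v, Q v) ->
  exists2 B : 'M[K]_n, B \in unitmx & forall i, G (row i B).
Proof.
move=> Gind.
pose free r := `[< exists2 A : 'M[K]_(r, n), row_free A &
  forall i, G (row i A) >].
have ex_free : exists r, free r.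
  exists 0%N; apply/asboolP; exists (0 : 'M[K]_(0, n)); last by case.
  by rewrite /row_free mxrank0.
have free_le r : free r -> (r <= n)%N.
  by move=> /asboolP[A /eqP rA _]; rewrite -rA rank_leq_col.
have [r /asboolP[A Afree AG] rmax] := ex_maxnP ex_free free_le.
have subA (v : 'rV_n) : (v <= A)%MS.
  apply: (Gind (fun v => (v <= A)%MS)) => [|u w|u Gu].
  - exact: sub0mx.
  - exact: addmx_sub.
  apply: contraT => uA.
  suff /rmax : free (1 + r)%N by rewrite ltnn.
  apply/asboolP; exists (col_mx u A); last first.
    move=> i; case: (split_ordP i) => j ->; last by rewrite rowKd.
    by rewrite rowKu ord1 row_id.
  rewrite /row_free eqn_leq rank_leq_row /=.
  suff : (\rank A < \rank (col_mx u A))%N by rewrite (eqP Afree).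
  rewrite ltn_neqAle -addsmxE mxrankS ?addsmxSr// andbT.
  apply: contra uA => /eqP rk.
  (* If adding [u] left the rank unchanged, [u] would already lie in the row space of [A]. *)
  have := (mxrank_leqif_sup (addsmxSr u A)).2; rewrite rk eqxx => /esym.
  exact: submx_trans (addsmxSl u A).
have Afull : row_full A by rewrite -sub1mx; apply/row_subP.
have rn : r = n by rewrite -(eqP Afree) (eqP Afull).
by subst r; exists A => //; rewrite -row_full_unit.
Qed.

(** * Finite families of functions whose span is stable under partial derivatives *)

Section InvariantFamily.
Variables (R : realType) (n : nat) (b : 'I_n.+1 -> ('rV[R]_2 -> R[i])).
Variable M : 'I_2 -> 'M[R[i]]_n.+1.
Implicit Types (v w : 'rV[R[i]]_n.+1) (x : 'rV[R]_2).

Definition comb v : 'rV[R]_2 -> R[i] := \sum_j v 0 j *: b j.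

Lemma combE v x : comb v x = \sum_j v 0 j * b j x.
Proof. by rewrite /comb fct_sumE. Qed.

Lemma comb_linear a v w : comb (a *: v + w) = a *: comb v + comb w.
Proof.
rewrite /comb scaler_sumr -big_split /=; apply: eq_bigr => j _.
by rewrite !mxE scalerDl scalerA.
Qed.

Lemma comb0 : comb 0 = 0.
Proof. by rewrite /comb big1// => j _; rewrite mxE scale0r. Qed.

Lemma combD v w : comb (v + w) = comb v + comb w.
Proof. by rewrite -[v in LHS]scale1r comb_linear scale1r. Qed.

Lemma combD_app v w x : comb (v + w) x = comb v x + comb w x.
Proof. by rewrite combD. Qed.

Lemma combZ a v : comb (a *: v) = a *: comb v.
Proof. by rewrite -[_ *: v]addr0 comb_linear comb0 addr0. Qed.

Lemma combZ_app a v x : comb (a *: v) x = a * comb v x.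
Proof. by rewrite combZ. Qed.

(** Differentiation acts on coordinate rows from the right: [v *m M 0 *m M 1] means first the
    derivative of index 0, then that of index 1. *)
Hypothesis partialM : forall i v x,
  is_cpartial i (comb v) x (comb (v *m M i) x).

(** On the line through [x] parallel to axis [i], the rows [v *m (M i - a%:M) ^+ j] give a Jordan
    chain that vanishes from index [N] on. *)
Lemma comb_taylor i a v N x : v *m (M i - a%:M) ^+ N = 0 ->
  comb v x = cexp (a * (x 0 i)%:C) *
    taylor N (fun j => comb (v *m (M i - a%:M) ^+ j) (along i x 0)) (x 0 i).
Proof.
move=> vN.
pose u j t := comb (v *m (M i - a%:M) ^+ j) (along i x t).
have du j t : is_cderive t (u j) (a * u j t + u j.+1 t).
  have := is_cpartial_along (partialM i (v *m (M i - a%:M) ^+ j)) x t.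
  congr is_cderive; rewrite -combZ_app -combD_app; congr comb.
  by rewrite exprSr -[_ * _]/(_ *m _) mulmxA mulmxBr mul_mx_scalar [RHS]addrC subrK.
have uN s : u N s = 0 by rewrite /u vN comb0.
by have := jordan_chain_solution du uN (x 0 i); rewrite /u mulmx1 along_id.
Qed.

(** In the expansion along coordinate 0, the exponential and the powers do not depend on coordinate
    1, so differentiating in the latter affects only the coefficients. *)
Lemma comb_taylor_transverse a v N x : v *m (M 0 - a%:M) ^+ N = 0 ->
  comb (v *m M 1) x = cexp (a * (x 0 0)%:C) *
    taylor N (fun j => comb (v *m (M 0 - a%:M) ^+ j *m M 1) (along 0 x 0))
      (x 0 0).
Proof.
move=> vN; apply: is_cderive_unique (partialM 1 v x) _.
have coord t : along 1 x t 0 0 = x 0 0 by rewrite mxE.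
under eq_fun do rewrite (comb_taylor _ vN) coord.
apply: is_cderiveZ; rewrite /taylor; apply: is_cderive_sum => j.
apply: is_cderiveZ.
have := partialM 1 (v *m (M 0 - a%:M) ^+ j) (along 0 x 0).
rewrite /is_cpartial mxE /=; congr is_cderive; apply/funext => t.
(* Replacing coordinate 0 and replacing coordinate 1 can be done in either order. *)
congr comb; apply/rowP => k; rewrite !mxE; case: eqP => // ->.
by case: eqP.
Qed.

Lemma comb_inj : lin_indep b -> injective comb.
Proof.
move=> b_indep v w vw; apply/subr0_eq/rowP => j; rewrite [RHS]mxE.
by apply: (b_indep (fun k => (v - w) 0 k)); rewrite -/(comb _) combD -scaleN1r combZ vw scaleN1r subrr.
Qed.

(* For v in a generalized eigenspace of M 0, the expansion of comb (v *m M 1) along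
   x^1 can be differentiated term by term, which replaces Schwarz's theorem on mixed partials. *)
Lemma comb_commute : lin_indep b -> GRing.comm (M 0) (M 1).
Proof.
move=> b_indep.
suff MM v : comb (v *m M 0 *m M 1) = comb (v *m M 1 *m M 0).
  apply/row_matrixP => i; rewrite !rowE.
  rewrite -[M 0 * M 1]/(M 0 *m M 1) -[M 1 * M 0]/(M 1 *m M 0).
  by rewrite !mulmxA; exact: comb_inj (MM _).
apply: (@generalized_eigenvector_ind _ _ (M 0) (fun=> True)
  (fun v => comb (v *m M 0 *m M 1) = comb (v *m M 1 *m M 0))) => //.
- by rewrite !mul0mx.
- by move=> {}v w vE wE; rewrite !mulmxDl !combD vE wE.
move=> {}v a N _ vN; apply/funext => x; apply/esym.
(* Order [N.+1] for [v] and order [N] for its image under [M 0 - a%:M] match the derivative of a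
   Taylor sum, which loses one term. *)
have vN1 : v *m (M 0 - a%:M) ^+ N.+1 = 0 by rewrite exprSr -[_ * _]/(_ *m _) mulmxA vN mul0mx.
have v1N : v *m (M 0 - a%:M) *m (M 0 - a%:M) ^+ N = 0.
  by rewrite -mulmxA -[_ *m _ ^+ _]/(_ * _) -exprS.
apply: is_cderive_unique (partialM 0 (v *m M 1) x) _.
under eq_fun do rewrite (comb_taylor_transverse _ vN1) along_coord along_along.
(* Writing [M 0] as [a + (M 0 - a)] produces the two terms of the product rule for the exponential
   times the Taylor sum. *)
have -> : comb (v *m M 0 *m M 1) x =
    a * comb (v *m M 1) x + comb (v *m (M 0 - a%:M) *m M 1) x.
  rewrite -combZ_app -combD_app; congr comb.
  by rewrite mulmxBr mul_mx_scalar mulmxBl -scalemxAl [RHS]addrC subrK.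
rewrite (comb_taylor_transverse _ vN1) (comb_taylor_transverse _ v1N).
have -> : (fun j => comb (v *m (M 0 - a%:M) *m (M 0 - a%:M) ^+ j *m M 1)
      (along 0 x 0)) =
    (fun j => comb (v *m (M 0 - a%:M) ^+ j.+1 *m M 1) (along 0 x 0)).
  by apply/funext => j; rewrite exprS -[_ * _]/(_ *m _) !mulmxA.
exact: is_cderive_exp_taylor a N (fun j =>
  comb (v *m (M 0 - a%:M) ^+ j *m M 1) (along 0 x 0)) (x 0 0).
Qed.

Lemma joint_eigenvector_exp_poly a c v N N' : GRing.comm (M 0) (M 1) ->
  v *m (M 0 - a%:M) ^+ N = 0 -> v *m (M 1 - c%:M) ^+ N' = 0 ->
  exists p : mpoly 2 R[i],
    comb v = exp_poly (fun i => if i == 0 then a else c) p.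
Proof.
move=> M01 vN vN'.
(* Coefficients of the double expansion, evaluated at the origin: first in coordinate 0, then in
   coordinate 1. *)
pose C j k := comb (v *m (M 0 - a%:M) ^+ j *m (M 1 - c%:M) ^+ k) 0.
exists (\sum_(0 <= j < N) \sum_(0 <= k < N')
  (j`!%:R^-1 * k`!%:R^-1 * C j k) *:
    (mpolyX _ (mnm1 0) ^+ j * mpolyX _ (mnm1 1) ^+ k)).
apply/funext => x; rewrite (comb_taylor _ vN) /exp_poly.
rewrite big_ord_recl big_ord1 /= cexpD -mulrA; congr (_ * _).
rewrite /taylor raddf_sum mulr_sumr; apply: eq_bigr => j _ /=.
(* Commutation keeps the coefficient functions in the generalized eigenspace of [M 1], so they can
   be expanded in turn. *)
have vjN' : v *m (M 0 - a%:M) ^+ j *m (M 1 - c%:M) ^+ N' = 0.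
  rewrite -mulmxA (_ : _ *m _ = (M 1 - c%:M) ^+ N' *m (M 0 - a%:M) ^+ j).
    by rewrite mulmxA vN' mul0mx.
  apply: commrX; apply/commr_sym/commrX/commrB; last exact: comm_mx_scalar.
  by apply/commr_sym/commrB => //; exact: comm_mx_scalar.
rewrite (comb_taylor _ vjN') /taylor raddf_sum /=.
have -> : along 0 x 0 0 1 = x 0 1 by rewrite mxE.
have -> : along 1 (along 0 x 0) 0 = 0.
  apply/rowP => k; rewrite !mxE.
  by case: k => [[|[|//]] ?].
have -> : lift ord0 ord0 = 1 :> 'I_2 by exact: val_inj.
rewrite mulrCA mulr_sumr; congr (_ * _); apply: eq_bigr => k _.
by rewrite mevalZ mevalM !rmorphXn /= !mevalXU /C; ring.
Qed.

End InvariantFamily.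

(** * Application to a finite dimensional space of smooth functions stable under partial
    derivatives *)

Lemma is_cpartial_comb (R : realType) n (b : 'I_n.+1 -> ('rV[R]_2 -> R[i])) i
    (A : 'M[R[i]]_n.+1) :
  (forall j, csmooth (b j)) -> (forall j, cpartial i (b j) = comb b (row j A)) ->
  forall v x, is_cpartial i (comb b v) x (comb b (v *m A) x).
Proof.
move=> bs bA v x.
have -> : comb b (v *m A) x = \sum_j v 0 j * cpartial i (b j) x.
  rewrite combE (eq_bigr (fun k => \sum_j v 0 j * A j k * b k x)); last first.
    by move=> k _; rewrite mxE mulr_suml.
  rewrite exchange_big; apply: eq_bigr => j _ /=.
  rewrite bA combE mulr_sumr; apply: eq_bigr => k _.
  by rewrite mxE mulrA.
rewrite /is_cpartial; under eq_fun do rewrite combE.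
apply: is_cderive_sum => j; apply: is_cderiveZ.
exact: csmooth_is_cpartial.
Qed.

(** Coordinate rows of exponential polynomials include all joint generalized eigenvectors, hence
    contain the rows of an invertible matrix [B], which serves as a change of basis. *)
Lemma exp_poly_basis (R : realType) (E : set ('rV[R]_2 -> R[i])) :
  E `<=` (@csmooth R) -> (forall i f, E f -> E (cpartial i f)) ->
  finite_dimensional E ->
  exists (n : nat) (b : 'I_n -> ('rV[R]_2 -> R[i])),
    is_basis E b /\
    forall j, exists (a : 'I_2 -> R[i]) (p : mpoly 2 R[i]), b j = exp_poly a p.
Proof.
move=> Esmooth Epartial [[|n] [b [b_indep bE]]].
  (* The zero space is treated apart, as the matrices below have size [n.+1]. *)
  by exists 0%N, b; split => // -[].
have Eb j : E (b j).
  rewrite -bE; exists (fun k => (k == j)%:R).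
  rewrite (bigD1 j) //= eqxx scale1r big1 ?addr0// => k /negPf ->.
  by rewrite scale0r.
have /choice[c cE] (ij : 'I_2 * 'I_n.+1) : exists c : 'I_n.+1 -> R[i],
    cpartial ij.1 (b ij.2) = \sum_k c k *: b k.
  by have := Epartial ij.1 _ (Eb ij.2); rewrite -bE.
pose M i := \matrix_(j, k) c (i, j) k.
have partialM i v x : is_cpartial i (comb b v) x (comb b (v *m M i) x).
  apply: is_cpartial_comb => j; first exact: Esmooth.
  by rewrite (cE (i, j)); apply: eq_bigr => k _; rewrite !mxE.
have M01 := comb_commute partialM b_indep.
have [B Bunit Brow] := @invertible_rows _ _
  (fun v => exists (a : 'I_2 -> R[i]) (p : mpoly 2 R[i]),
    comb b v = exp_poly a p) (fun Q Q0 QD QG =>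
  joint_generalized_eigenvector_ind M01 Q0 QD (fun w a a' N N' wa wa' =>
    QG w (ex_intro _ _ (joint_eigenvector_exp_poly partialM M01 wa wa')))).
exists n.+1, (fun j => comb b (row j B)); split => //.
have sumB (d : 'I_n.+1 -> R[i]) : \sum_j d j *: comb b (row j B) =
    comb b (\row_j d j *m B).
  rewrite mulmx_sum_row; under eq_bigr do rewrite -combZ.
  rewrite -(big_morph _ (combD b) (comb0 b)); congr comb.
  by apply: eq_bigr => j _; rewrite mxE.
split.
  move=> d; rewrite sumB -(comb0 b) => /(comb_inj b_indep) dB j.
  have := mulmxK Bunit (\row_j d j); rewrite dB mul0mx => /rowP/(_ j).
  by rewrite !mxE.
rewrite -bE; apply/seteqP; split => f [d ->] /=.
  by rewrite sumB; exists (fun j => (\row_j d j *m B) 0 j).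
(* Coordinates in the new basis come from the old ones through the inverse of [B]. *)
exists (fun j => (\row_j d j *m invmx B) 0 j); rewrite sumB.
have -> : \row_j (\row_j d j *m invmx B) 0 j = \row_j d j *m invmx B.
  by apply/rowP => j; rewrite mxE.
by rewrite mulmxKV// /comb; apply: eq_bigr => j _; rewrite mxE.
Qed.

Theorem theorem1p9 (R : realType) (E : set ('rV[R]_2 -> R[i]))
    (submodE : diff_submodule E) (fdimE : finite_dimensional E) :
  (exists (n : nat) (b : 'I_n -> ('rV[R]_2 -> R[i])),
     is_basis E b /\
     forall j : 'I_n, exists (a : 'I_2 -> R[i]) (p : mpoly 2 R[i]),
       b j = exp_poly a p) /\
  (forall (a : 'I_2 -> R[i]) (p : mpoly 2 R[i]), E (exp_poly a p) ->
     forall i : 'I_2, E (exp_poly a (mderiv i p))).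
Proof.
have [Esmooth [_ Elin] Epartial] := submodE.
split; first exact: exp_poly_basis.
move=> a p Ep i.
(* By the product rule, differentiating the function and subtracting [a i] times it leaves only the
   derivative of the polynomial factor. *)
have -> : exp_poly a (mderiv i p) =
    (- a i) *: exp_poly a p + cpartial i (exp_poly a p).
  rewrite cpartial_exp_poly; apply/funext => x.
  rewrite /exp_poly -[RHS]/(- a i * (cexp _ * _) + cexp _ * _).
  by rewrite mevalD mevalZ; ring.
have := Elin (- a i) (exp_poly a p) (cpartial i (exp_poly a p)).
by rewrite !inE; apply => //; exact: Epartial.
Qed.
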